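(* Let $n\ge2$. If $C\subset\mathbb{S}^{n-1}$ is an antipodal spherical $5$-design, then $$\left(\frac{3}{n+2}\right)^{1/2}\le\rho(C)\le\left(\frac1n+\frac1n\sqrt{\frac{(n-1)(|C|-2n)}{n(n+2)}}\,\right)^{1/2}.$$
   Context: A finite set $C\subset\mathbb{S}^{n-1}\subset\mathbb{R}^n$ is a spherical $\tau$-design if for every polynomial $f(x_1,\dots,x_n)$ of degree at most $\tau$ the average of $f$ over $C$ equals the average of $f$ over $\mathbb{S}^{n-1}$ with respect to the (rotation-invariant) Lebesgue measure. It is antipodal if $C=-C$. $\rho(C):=\min_{y\in\mathbb{S}^{n-1}}\max_{x\in C}\langle x,y\rangle$ (equivalently $\rho(C)=1-r(C)^2/2$, where $r(C)=\max_{y\in\mathbb{S}^{n-1}}\min_{x\in C}d(x,y)$ is the covering radius of $C$ in Euclidean distance). *)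

(* Defs.v *)
From mathcomp Require Import all_boot all_order all_algebra finmap.
From mathcomp Require Import all_classical all_reals all_analysis.
From mathcomp Require Import (canonicals, coercions) mpoly.

Set Implicit Arguments.
Unset Strict Implicit.
Unset Printing Implicit Defensive.

Import Order.TTheory GRing.Theory Num.Theory.

Local Open Scope classical_set_scope.
Local Open Scope ring_scope.

Section SphericalDesigns.
Context {R : realType}.

Definition dot (n : nat) (x y : 'rV[R]_n) : R := \sum_(i < n) x 0 i * y 0 i.

Definition sphere (n : nat) : set 'rV[R]_n := [set x | dot x x = 1].

(* Integral of f over the unit sphere S^(n-1) of R^n against its
   (unnormalized, rotation-invariant) Lebesgue surface measure sigma_(n-1),
   written in spherical coordinates: with x = (cos t, sin t * xi),
   0 <= t <= pi and xi in S^k, one has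
     d sigma_(k+1)(x) = (sin t)^k dt d sigma_k(xi),
   and sigma_0 is the counting measure on S^0 = {1, -1}.  In dimension n = 0
   the sphere is empty. *)
Fixpoint sphere_integral (n : nat) : ('rV[R]_n -> R) -> R :=
  match n return ('rV[R]_n -> R) -> R with
  | 0 => fun=> 0
  | m.+1 =>
    match m return (('rV[R]_m -> R) -> R) -> ('rV[R]_m.+1 -> R) -> R with
    | 0 => fun _ f => f (const_mx 1) + f (const_mx (-1))
    | k.+1 => fun sphere_integral_k f =>
        \int[lebesgue_measure]_(t in `[0, pi])
          (sin t ^+ k *
           sphere_integral_k (fun xi : 'rV[R]_k.+1 =>
             f (row_mx (cos t)%:M (sin t *: xi) : 'rV[R]_(1 + k.+1))))
    end (@sphere_integral m)
  end.

Definition sphere_average (n : nat) (f : 'rV[R]_n -> R) : R :=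
  sphere_integral f / sphere_integral (fun _ : 'rV[R]_n => 1).

Definition polyfun (n : nat) (p : mpoly.mpoly n R) (x : 'rV[R]_n) : R :=
  mpoly.meval (fun i => x 0 i) p.

(* [msize p] is 1 + the total degree of p (and 0 for p = 0).  The empty set is
   not a design, already because of p = 1. *)
Definition spherical_design (n tau : nat) (C : {fset 'rV[R]_n}) : Prop :=
  [set` C] `<=` @sphere n /\
  forall p : mpoly.mpoly n R, (mpoly.msize p <= tau.+1)%N ->
    (\sum_(x <- C) polyfun p x) / #|` C|%:R = sphere_average (polyfun p).

Definition antipodal (n : nat) (C : {fset 'rV[R]_n}) : Prop :=
  [fset - x | x in C]%fset = C.

(* For C finite and nonempty the inner supremum is a maximum; the infimum is a
   minimum, by continuity and compactness of the sphere. *)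
Definition rho (n : nat) (C : {fset 'rV[R]_n}) : R :=
  inf [set sup [set dot x y | x in [set` C]] | y in @sphere n].

End SphericalDesigns.

(* Main.v *)
Require Import Defs.
From mathcomp Require Import all_boot all_order all_algebra finmap.
From mathcomp Require Import all_classical all_reals all_analysis.
From mathcomp Require Import (canonicals, coercions) mpoly.
From mathcomp Require Import ring lra.

Import Order.TTheory GRing.Theory Num.Theory.
Import numFieldNormedType.Exports.

Local Open Scope ring_scope.

(** A 5-design has the second and fourth moments of the sphere: the averages of
    <x,y>^2 and <x,y>^4 over C are |y|^2/n and 3|y|^4/(n(n+2)).  If s is the
    maximum of <x,y> on the antipodal set C, then <x,y>^4 <= s^2 <x,y>^2, and
    averaging gives the lower bound.  For the upper bound, take y along a vertex
    z of the polytope {z : <x,z> <= 1 for x in C}: at least n points of C, hence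
    with their antipodes at least 2n, have <x,y>^2 = s^2, and Cauchy-Schwarz
    against the indicator of these points bounds (s^2 - 1/n)^2 by the variance of
    <x,y>^2 on C. *)

(** * The standard inner product on row vectors *)

Lemma dotC (R : realType) (n : nat) (x y : 'rV[R]_n) : dot x y = dot y x.
Proof. by apply: eq_bigr => i _; rewrite mulrC. Qed.

Lemma dotZr (R : realType) (n : nat) (a : R) (x y : 'rV[R]_n) :
  dot x (a *: y) = a * dot x y.
Proof. by rewrite /dot mulr_sumr; apply: eq_bigr => i _; rewrite !mxE mulrCA. Qed.

Lemma dotZl (R : realType) (n : nat) (a : R) (x y : 'rV[R]_n) :
  dot (a *: x) y = a * dot x y.
Proof. by rewrite dotC dotZr dotC. Qed.

Lemma dotNl (R : realType) (n : nat) (x y : 'rV[R]_n) : dot (- x) y = - dot x y.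
Proof. by rewrite -scaleN1r dotZl mulN1r. Qed.

Lemma dotDr (R : realType) (n : nat) (x y z : 'rV[R]_n) :
  dot x (y + z) = dot x y + dot x z.
Proof. by rewrite /dot -big_split; apply: eq_bigr => i _; rewrite !mxE mulrDr. Qed.

Lemma dot0r (R : realType) (n : nat) (x : 'rV[R]_n) : dot x 0 = 0.
Proof. by rewrite /dot big1 // => i _; rewrite mxE mulr0. Qed.

Lemma dot_row_mx (R : realType) (n : nat) (a b : R) (x y : 'rV[R]_n) :
  dot (row_mx a%:M x : 'rV_(1 + n)) (row_mx b%:M y) = a * b + dot x y.
Proof.
rewrite /dot big_split_ord /= big_ord1; congr (_ + _).
  by rewrite !row_mxEl !mxE !mulr1n.
by apply: eq_bigr => i _; rewrite !row_mxEr.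
Qed.

Lemma dot_ge0 (R : realType) (n : nat) (x : 'rV[R]_n) : 0 <= dot x x.
Proof. by apply: sumr_ge0 => i _; rewrite -expr2 sqr_ge0. Qed.

Lemma dot_gt0 (R : realType) (n : nat) (x : 'rV[R]_n) : x != 0 -> 0 < dot x x.
Proof.
rewrite lt0r dot_ge0 andbT; apply: contraNneq => xx0; apply/eqP/rowP => i.
rewrite mxE; apply/eqP; rewrite -sqrf_eq0 expr2; apply/eqP.
by apply: (psumr_eq0P _ xx0) => // j _; rewrite -expr2 sqr_ge0.
Qed.

Lemma dot_sphere_le1 (R : realType) (n : nat) (x y : 'rV[R]_n) :
  sphere x -> sphere y -> dot x y <= 1.
Proof.
rewrite /sphere /= => xx yy; have := dot_ge0 _ _ (x + (-1) *: y).
rewrite dotDr !(dotC _ _ (_ + _)) !dotDr dotZr !dotZl !dotZr xx yy (dotC _ _ y x).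
lra.
Qed.

(** * Integrals of powers of sine and cosine over [[0, pi]] *)

Lemma Rintegral_derive (R : realType) (F f : R -> R) (a b : R) :
  a < b -> continuous f -> (forall x : R, is_derive x 1 F (f x)) ->
  \int[lebesgue_measure]_(x in `[a, b]%classic) f x = F b - F a.
Proof.
move=> ab cf dF.
have cF : continuous F.
  by move=> x; apply/differentiable_continuous/derivable1_diffP; apply: ex_derive.
rewrite /Rintegral (@continuous_FTC2 _ f F) //.
- exact: continuous_subspaceT.
- split => [x _||]; first exact: ex_derive.
  + exact/cvg_at_right_filter/cF.
  + exact/cvg_at_left_filter/cF.
- by move=> x _; rewrite derive1E; apply: derive_val.
Qed.

Lemma continuous_itv_integrable (R : realType) (f : R -> R) (a b : R) :
  continuous f -> (@lebesgue_measure R).-integrable `[a, b]%classic (EFin \o f).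
Proof.
move=> cf; apply: continuous_compact_integrable; first exact: segment_compact.
exact: continuous_subspaceT.
Qed.

Lemma continuous_mul (R : realType) (f g : R -> R) :
  continuous f -> continuous g -> continuous (fun t => f t * g t).
Proof. by move=> cf cg x; exact: (@continuousM R R f g x (cf x) (cg x)). Qed.

Lemma continuous_add (R : realType) (f g : R -> R) :
  continuous f -> continuous g -> continuous (fun t => f t + g t).
Proof. by move=> cf cg x; exact: (@continuousD R R R f g x (cf x) (cg x)). Qed.

Lemma continuous_exp (R : realType) (f : R -> R) k :
  continuous f -> continuous (fun t => f t ^+ k).
Proof.
move=> cf; elim: k => [|k IH]; first exact: cst_continuous.
under eq_fun do rewrite exprS.
exact: continuous_mul.
Qed.

(** Up to a multiple of [sin t ^+ k], the integrand is the derivative of a function with the factor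
    [sin t ^+ k.+1], which vanishes at 0 and pi even for [k = 0]. *)
Lemma Rintegral_sinX_quartic_cos (R : realType) (k : nat) (c0 c1 c2 c3 c4 : R) :
  \int[lebesgue_measure]_(t in `[0, pi]%classic)
    (sin t ^+ k * (c0 + c1 * cos t + c2 * cos t ^+ 2 + c3 * cos t ^+ 3 +
                   c4 * cos t ^+ 4)) =
  (c0 + c2 / k.+2%:R + 3 * c4 / (k.+2%:R * k.+4%:R)) *
  \int[lebesgue_measure]_(t in `[0, pi]%classic) sin t ^+ k.
Proof.
set p := fun t : R => _ : R.
set c := c0 + _ + _.
have cs : continuous (fun t : R => sin t ^+ k) by exact/continuous_exp/continuous_sin.
have cc j : continuous (fun t : R => cos t ^+ j) by exact/continuous_exp/continuous_cos.
have ccst (a : R) : continuous (fun _ : R => a) by exact: cst_continuous.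
have cp : continuous p.
  apply: continuous_mul => //; do 3![apply: continuous_add; last exact: continuous_mul].
  by apply: continuous_add => //; apply: continuous_mul => //; exact: continuous_cos.
have ccs : continuous (fun t : R => c * sin t ^+ k) by exact: continuous_mul.
(* The derivative of [sin t ^+ k.+1 * cos t ^+ j] is
   [sin t ^+ k * ((k + j + 1) cos t ^+ j.+1 - j cos t ^+ j.-1)]. *)
pose e3 := c4 / k.+4%:R.
pose e2 := c3 / k.+3%:R.
pose e1 := (c2 + 3 * e3) / k.+2%:R.
pose e0 := (c1 + 2 * e2) / k.+1%:R.
pose F (t : R) := sin t ^+ k.+1 * (e0 + e1 * cos t + e2 * cos t ^+ 2 + e3 * cos t ^+ 3).
(* [e3] down to [e0] come from matching the coefficients of [cos t ^+ 4] down to [cos t]; the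
   constant terms then give [c = c0 + e1]. *)
have dF (t : R) : is_derive t 1 F (p t - c * sin t ^+ k).
  have -> : F = (@sin R ^+ k.+1) *
      (cst e0 + e1 *: @cos R + e2 *: (@cos R ^+ 2) + e3 *: (@cos R ^+ 3)).
    by apply/funext => x; rewrite /F !fctE.
  have dsin := is_deriveX k.+1 (is_derive_sin t).
  have dcos a j := is_deriveZ a (is_deriveX j (is_derive_cos t)).
  have d1 := is_deriveD (is_derive_cst e0 t (1 : R)) (is_deriveZ e1 (is_derive_cos t)).
  apply: (is_derive_eq (is_deriveM dsin
    (is_deriveD (is_deriveD d1 (dcos e2 2%N)) (dcos e3 3%N)))).
  rewrite /p /c /GRing.scale /= /e0 /e1 /e2 /e3.
  rewrite !fctE /= /GRing.scale /= [sin t ^+ k.+1]exprSr.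
  have := sin2cos2 t; rewrite -[cos t ^+ 1]/(cos t).
  move: (sin t) (cos t) => s u s2.
  transitivity (s ^+ k * ((c4 / k.+4%:R) * (k.+1%:R * u ^+ 4 - 3 * s ^+ 2 * u ^+ 2)
    + c3 / k.+3%:R * (k.+1%:R * u ^+ 3 - 2 * s ^+ 2 * u)
    + (c2 + 3 * (c4 / k.+4%:R)) / k.+2%:R * (k.+1%:R * u ^+ 2 - s ^+ 2)
    + (c1 + 2 * (c3 / k.+3%:R)) / k.+1%:R * (k.+1%:R * u))); first by ring.
  rewrite s2; field.
  by rewrite -!(natrD R _ k) -[1 + k%:R](natrD R 1 k) !pnatr_eq0.
apply: (etrans _ (RintegralZl c _ _)) => //; last exact: continuous_itv_integrable.
apply/eqP; rewrite -subr_eq0 -RintegralB //; try exact: continuous_itv_integrable.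
rewrite (Rintegral_derive _ F) //; first last.
- by move=> x; apply: (@continuousB R R R p _ x); [exact: cp|exact: ccs].
- exact: pi_gt0.
by rewrite /F sinpi sin0 !expr0n /= !mul0r subrr.
Qed.

(** With [sin t ^+ 2 = 1 - cos t ^+ 2], the quartic formula yields the factor [1 - 1 / (k + 2)]
    between the exponents [k] and [k + 2]. The recursion skips an exponent, so the induction carries
    two consecutive ones. *)
Lemma Rintegral_sinX_gt0 (R : realType) (k : nat) :
  0 < \int[lebesgue_measure]_(t in `[0, pi]%classic) (sin t ^+ k : R).
Proof.
suff [] : 0 < \int[lebesgue_measure]_(t in `[0, pi]%classic) (sin t ^+ k : R) /\
  0 < \int[lebesgue_measure]_(t in `[0, pi]%classic) (sin t ^+ k.+1 : R) by [].
elim: k => [|k [IH IH']]; split => //.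
- under eq_Rintegral do rewrite expr0.
  rewrite Rintegral_cst //= lebesgue_measure_itv /= lte_fin pi_gt0 /=.
  by rewrite subr0 mul1r pi_gt0.
- have dF (x : R) : is_derive x 1 (- @cos R) (sin x ^+ 1).
    by apply: is_derive_eq; rewrite opprK expr1.
  rewrite (Rintegral_derive _ _ _ _ _ _ _ dF).
  + by rewrite !fctE cospi cos0; lra.
  + exact: pi_gt0.
  + exact/continuous_exp/continuous_sin.
- under eq_Rintegral => t _.
    rewrite (_ : sin t ^+ k.+2 = sin t ^+ k *
     (1 + 0 * cos t + (-1) * cos t ^+ 2 + 0 * cos t ^+ 3 + 0 * cos t ^+ 4)); last first.
      by rewrite -addn2 exprD sin2cos2; ring.
    over.
  rewrite Rintegral_sinX_quartic_cos mulr_gt0 //.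
  rewrite mulr0 mul0r addr0 mulN1r subr_gt0 invf_lt1 ?ltr1n //.
Qed.

(** * Integrals over the sphere of quartics in a linear form *)

Lemma sphere_integralSS (R : realType) (k : nat) (f : 'rV[R]_k.+2 -> R) :
  sphere_integral f =
  \int[lebesgue_measure]_(t in `[0, pi]%classic)
    (sin t ^+ k * sphere_integral (fun xi : 'rV[R]_k.+1 =>
      f (row_mx (cos t)%:M (sin t *: xi) : 'rV[R]_(1 + k.+1)))).
Proof. by []. Qed.

Lemma sphere_integral1 (R : realType) (k : nat) :
  sphere_integral (fun _ : 'rV[R]_k.+2 => 1) =
  sphere_integral (fun _ : 'rV[R]_k.+1 => 1) *
  \int[lebesgue_measure]_(t in `[0, pi]%classic) sin t ^+ k.
Proof.
rewrite mulrC -RintegralZr //; apply: continuous_itv_integrable.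
exact/continuous_exp/continuous_sin.
Qed.

Lemma sphere_integral1_gt0 (R : realType) (n : nat) :
  0 < sphere_integral (fun _ : 'rV[R]_n.+1 => 1).
Proof.
elim: n => [|n IH]; first by rewrite /= addr_gt0.
by rewrite sphere_integral1 mulr_gt0 // Rintegral_sinX_gt0.
Qed.

(* Quantifying over all quartics in [dot y x] lets the induction on the
   dimension go through without linearity of [sphere_integral]. *)
Lemma sphere_integral_quartic (R : realType) (n : nat) (y : 'rV[R]_n.+1)
    (a0 a1 a2 a3 a4 : R) :
  sphere_integral (fun x => a0 + a1 * dot y x + a2 * dot y x ^+ 2 +
                            a3 * dot y x ^+ 3 + a4 * dot y x ^+ 4) =
  (a0 + a2 * dot y y / n.+1%:R +
   3 * a4 * dot y y ^+ 2 / (n.+1%:R * n.+3%:R)) *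
  sphere_integral (fun _ : 'rV[R]_n.+1 => 1).
Proof.
elim: n => [|k IH] in y a0 a1 a2 a3 a4 *.
  by rewrite /= /dot !big_ord1 !mxE; field.
rewrite sphere_integral1 -[y](@hsubmxK _ 1 1 k.+1).
set b : R := lsubmx (y : 'M[R]_(1, 1 + k.+1)) 0 0.
set z := rsubmx _; have -> : lsubmx (y : 'M[R]_(1, 1 + k.+1)) = b%:M by rewrite -mx11_scalar.
rewrite dot_row_mx sphere_integralSS.
pose q := dot z z; set S := sphere_integral (fun _ : 'rV_k.+1 => 1).
(* The averages of [dot z xi ^+ 2] and [dot z xi ^+ 4] over the sphere of one dimension less. *)
pose alpha := q / k.+1%:R; pose beta := 3 * q ^+ 2 / (k.+1%:R * k.+3%:R).
under eq_Rintegral => t _.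
  (* Since [dot y x = b * cos t + sin t * dot z xi], for fixed [t] the integrand is again a quartic,
     now in [dot z xi]. *)
  rewrite [X in sphere_integral X](_ : _ = fun xi =>
      (a0 + a1 * (b * cos t) + a2 * (b * cos t) ^+ 2 + a3 * (b * cos t) ^+ 3 +
       a4 * (b * cos t) ^+ 4) +
      (a1 + 2 * a2 * (b * cos t) + 3 * a3 * (b * cos t) ^+ 2 +
       4 * a4 * (b * cos t) ^+ 3) * sin t * dot z xi +
      (a2 + 3 * a3 * (b * cos t) + 6 * a4 * (b * cos t) ^+ 2) * sin t ^+ 2 *
       dot z xi ^+ 2 +
      (a3 + 4 * a4 * (b * cos t)) * sin t ^+ 3 * dot z xi ^+ 3 +
      a4 * sin t ^+ 4 * dot z xi ^+ 4); last first.
    by apply/funext => xi; rewrite dot_row_mx dotZr; ring.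
  rewrite IH -/S -/q.
  (* [IH] has removed the odd powers of [dot z xi], so apart from the weight [sin t] occurs only in
     even powers, which are polynomials in [cos t]. *)
  rewrite (_ : _ * _ = sin t ^+ k * (
      S * (a0 + a2 * alpha + a4 * beta) +
      S * (a1 * b + 3 * a3 * b * alpha) * cos t +
      S * (a2 * b ^+ 2 + 6 * a4 * b ^+ 2 * alpha - a2 * alpha - 2 * a4 * beta) *
       cos t ^+ 2 +
      S * (a3 * b ^+ 3 - 3 * a3 * b * alpha) * cos t ^+ 3 +
      S * (a4 * b ^+ 4 - 6 * a4 * b ^+ 2 * alpha + a4 * beta) * cos t ^+ 4)); last first.
    rewrite (_ : sin t ^+ 4 = (1 - cos t ^+ 2) ^+ 2); last by rewrite -sin2cos2; ring.
    by rewrite sin2cos2 /alpha /beta; ring.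
  over.
rewrite Rintegral_sinX_quartic_cos -/q /alpha /beta.
set J := \int[_]_(_ in _) _.
field.
by rewrite -!(natrD R _ k) -[1 + k%:R](natrD R 1 k) !pnatr_eq0.
Qed.

(** * Second and fourth moments of a design *)

Definition linear_mpoly (R : realType) (n : nat) (y : 'rV[R]_n) : mpoly.mpoly n R :=
  \sum_(i < n) y 0 i *: mpoly.mpolyX R (mpoly.mnm1 i).
Arguments linear_mpoly {R n} y.

(** These powers are the polynomials on which the design property is tested; exponent 0 gives the
    constant 1. *)
Lemma polyfun_linear_mpolyX (R : realType) (n : nat) (y x : 'rV[R]_n) (k : nat) :
  polyfun (linear_mpoly y ^+ k) x = dot y x ^+ k.
Proof.
rewrite /polyfun rmorphXn /= raddf_sum /=; congr (_ ^+ _).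
by apply: eq_bigr => i _; rewrite mpoly.mevalZ mpoly.mevalXU.
Qed.

Lemma msize_linear_mpolyX (R : realType) (n : nat) (y : 'rV[R]_n) (k : nat) :
  (mpoly.msize (linear_mpoly y ^+ k) <= k.+1)%N.
Proof.
have hom : linear_mpoly y \in @mpoly.ishomog1 n R 1 mpoly.mdeg.
  apply: rpred_sum => i _; apply: rpredZ.
  by rewrite mpoly.dhomogX /= mpoly.mdeg1.
have homk := mpoly.dhomogMn k hom; rewrite mul1n in homk.
rewrite mpoly.msizeE; apply/bigmax_leqP_seq => m m_supp _.
by rewrite (mpoly.dhomog_mf homk m_supp).
Qed.

(** The polynomial 1 has average 1 over the sphere, whereas over an empty [C] its average would be
    0, because the inverse of 0 is 0. *)
Lemma design_card_gt0 (R : realType) (n : nat) (C : {fset 'rV[R]_n}) :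
  (0 < n)%N -> spherical_design 5 C -> 0 < #|` C|%:R :> R.
Proof.
case: n C => // n C _ [_ /(_ (linear_mpoly 0 ^+ 0))].
rewrite (leq_trans (msize_linear_mpolyX _ _ _ _)) // => /(_ isT).
rewrite /sphere_average (_ : polyfun _ = fun=> 1); last first.
  by apply/funext => x; rewrite polyfun_linear_mpolyX expr0.
rewrite divff ?gt_eqF ?sphere_integral1_gt0 // ltr0n lt0n => H.
by apply/eqP => C0; move: H => /eqP; rewrite C0 invr0 mulr0 eq_sym oner_eq0.
Qed.

Lemma design_moment2 (R : realType) (n : nat) (C : {fset 'rV[R]_n}) (y : 'rV[R]_n) :
  (0 < n)%N -> spherical_design 5 C ->
  \sum_(x <- C) dot x y ^+ 2 = #|` C|%:R * (dot y y / n%:R).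
Proof.
move=> n_gt0 dC; have C_gt0 := design_card_gt0 _ _ _ n_gt0 dC.
case: n C y n_gt0 dC C_gt0 => // n C y _ [_ /(_ (linear_mpoly y ^+ 2))].
rewrite (leq_trans (msize_linear_mpolyX _ _ _ _)) // => /(_ isT).
rewrite /sphere_average (_ : polyfun _ = fun x =>
  0 + 0 * dot y x + 1 * dot y x ^+ 2 + 0 * dot y x ^+ 3 + 0 * dot y x ^+ 4); last first.
  by apply/funext => x; rewrite polyfun_linear_mpolyX; ring.
rewrite sphere_integral_quartic mulfK ?gt_eqF ?sphere_integral1_gt0 // => H C_gt0.
apply: (mulIf (invr_neq0 (lt0r_neq0 C_gt0))).
rewrite mulrAC divff ?gt_eqF // mul1r (_ : dot y y / _ = 0 + 1 * dot y y / n.+1%:R +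
   3 * 0 * dot y y ^+ 2 / (n.+1%:R * n.+3%:R)); last by rewrite mulr0 !mul0r addr0 add0r mul1r.
rewrite -H; congr (_ / _); apply: eq_bigr => x _; rewrite (dotC _ _ x); ring.
Qed.

Lemma design_moment4 (R : realType) (n : nat) (C : {fset 'rV[R]_n}) (y : 'rV[R]_n) :
  (0 < n)%N -> spherical_design 5 C ->
  \sum_(x <- C) dot x y ^+ 4 = #|` C|%:R * (3 * dot y y ^+ 2 / (n%:R * (n%:R + 2))).
Proof.
move=> n_gt0 dC; have C_gt0 := design_card_gt0 _ _ _ n_gt0 dC.
case: n C y n_gt0 dC C_gt0 => // n C y _ [_ /(_ (linear_mpoly y ^+ 4))].
rewrite (leq_trans (msize_linear_mpolyX _ _ _ _)) // => /(_ isT).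
rewrite /sphere_average (_ : polyfun _ = fun x =>
  0 + 0 * dot y x + 0 * dot y x ^+ 2 + 0 * dot y x ^+ 3 + 1 * dot y x ^+ 4); last first.
  by apply/funext => x; rewrite polyfun_linear_mpolyX; ring.
rewrite sphere_integral_quartic mulfK ?gt_eqF ?sphere_integral1_gt0 // => H C_gt0.
apply: (mulIf (invr_neq0 (lt0r_neq0 C_gt0))).
rewrite mulrAC divff ?gt_eqF // mul1r -natrD addn2.
rewrite (_ : 3 * _ / _ = 0 + 0 * dot y y / n.+1%:R +
   3 * 1 * dot y y ^+ 2 / (n.+1%:R * n.+3%:R)); last by rewrite !mul0r !add0r mulr1.
rewrite -H; congr (_ / _); apply: eq_bigr => x _; rewrite (dotC _ _ x); ring.
Qed.

(** * Vertices of a polytope given by finitely many constraints *)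

Lemma exists_orthogonal (R : realType) (n : nat) (s : seq 'rV[R]_n) :
  (size s < n)%N -> exists2 d, d != 0 & {in s, forall x, dot x d = 0}.
Proof.
move=> s_lt; pose A : 'M[R]_(n, size s) := \matrix_(i, j) s`_j 0 i.
(* The columns of [A] are the vectors of [s]; its rank is below [n], so its left kernel has a
   nonzero row. *)
exists (nz_row (kermx A)).
  rewrite nz_row_eq0 -mxrank_eq0 mxrank_ker -lt0n subn_gt0.
  exact: leq_ltn_trans (rank_leq_col A) s_lt.
move=> x x_s; have /sub_kermxP/rowP/(_ (Ordinal (etrans (index_mem x s) x_s))) :=
  nz_row_sub (kermx A).
rewrite !mxE dotC => dA; rewrite -[RHS]dA.
by apply: eq_bigr => i _; rewrite mxE /= nth_index.
Qed.

Lemma exists_argmin (R : realType) (T : eqType) (s : seq T) (P : pred T) (r : T -> R) :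
  has P s -> exists x, [/\ x \in s, P x & {in s, forall y, P y -> r x <= r y}].
Proof.
elim: s => //= a s IH; case: (boolP (has P s)) => [/IH [x [x_s Px x_min]] _|no].
  have [Pa|nPa] := boolP (P a); last first.
    exists x; rewrite inE x_s orbT; split=> // y /[!inE] /predU1P [->|]; last exact: x_min.
    by rewrite (negPf nPa).
  have [rax|rxa] := leP (r a) (r x).
    exists a; rewrite mem_head; split=> // y /[!inE] /predU1P [->|y_s Py] //.
    exact: le_trans rax (x_min _ y_s Py).
  exists x; rewrite inE x_s orbT; split=> // y /[!inE] /predU1P [-> _|]; first exact: ltW.
  exact: x_min.
rewrite orbF => Pa; exists a; rewrite mem_head; split=> // y /[!inE] /predU1P [->|y_s Py] //.
by case/negP: no; apply/hasP; exists y.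
Qed.

Lemma ltn_count (T : eqType) (a b : pred T) (s : seq T) (x : T) :
  {in s, forall y, a y -> b y} -> x \in s -> b x -> ~~ a x -> (count a s < count b s)%N.
Proof.
move=> ab x_s bx nax.
rewrite -(size_filter b) -(count_predC a) !count_filter.
rewrite (_ : count (predI a b) s = count a s); last first.
  by apply: eq_in_count => y y_s /=; case: (boolP (a y)) => // /(ab y y_s) ->.
rewrite -addn1 leq_add2l -has_count; apply/hasP; exists x => //=.
by rewrite nax.
Qed.

(* Moving along a direction orthogonal to the tight constraints keeps them
   tight, until a further one becomes tight. *)
Lemma exists_vertex (R : realType) (n : nat) (s : seq 'rV[R]_n) :
  (forall d : 'rV[R]_n, d != 0 -> has (fun x => 0 < dot x d) s) ->
  exists2 z, {in s, forall x, dot x z <= 1} &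
    (n <= count (fun x => dot x z == 1%R) s)%N.
Proof.
move=> span_s.
(* Start at the origin, which is feasible, and gain tight constraints one at a time. *)
suff: forall k, (k <= n)%N -> exists2 z, {in s, forall x, dot x z <= 1} &
    (k <= count (fun x => dot x z == 1%R) s)%N by apply.
elim=> [_|k IH k_lt]; first by exists 0 => // x _; rewrite dot0r ler01.
have [z feas] := IH (ltnW k_lt).
rewrite leq_eqVlt => /predU1P [eq_k|]; last by exists z.
have [|d d_neq0 d_orth] := exists_orthogonal R n [seq x <- s | dot x z == 1].
  by rewrite size_filter -eq_k.
(* Along [d], the constraint of [x] becomes tight at time [(1 - dot x z) / dot x d], provided
   [dot x d] is positive; the earliest such time is chosen. *)
have [x [x_s xd_gt0 x_min]] :=
  exists_argmin _ _ _ _ (fun x => (1 - dot x z) / dot x d) (span_s d d_neq0).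
set t := _ / _ in x_min.
have t_ge0 : 0 <= t by rewrite divr_ge0 ?subr_ge0 ?feas // ltW.
exists (z + t *: d).
  move=> y y_s; rewrite dotDr dotZr; have [yd_le0|yd_gt0] := leP (dot y d) 0.
    by rewrite (le_trans _ (feas y y_s)) // gerDl mulr_ge0_le0.
  by rewrite addrC -lerBrDr -ler_pdivlMr // x_min.
rewrite eq_k; apply: (ltn_count _ _ _ _ x) => //=.
- move=> y y_s /= yz1; rewrite dotDr dotZr d_orth ?mulr0 ?addr0 //.
  by rewrite mem_filter yz1.
- by rewrite dotDr dotZr /t divfK ?lt0r_neq0 // subrKC.
- apply/negP => xz1; have := d_orth x; rewrite mem_filter xz1 => /(_ x_s) xd0.
  by rewrite xd0 ltxx in xd_gt0.
Qed.

(** * Antipodality and the lower bound *)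

Lemma antipodal_opp (R : realType) (n : nat) (C : {fset 'rV[R]_n}) (x : 'rV[R]_n) :
  antipodal C -> x \in C -> - x \in C.
Proof. by move=> antiC x_C; rewrite -antiC; apply/imfsetP; exists x. Qed.

Lemma antipodal_sum (R : realType) (n : nat) (C : {fset 'rV[R]_n}) (F : 'rV[R]_n -> R) :
  antipodal C -> \sum_(x <- C) F (- x) = \sum_(x <- C) F x.
Proof.
move=> antiC; rewrite -[in RHS]antiC big_imfset //=.
by move=> x y _ _; apply: oppr_inj.
Qed.

(** Otherwise antipodality makes [dot x d] vanish on all of [C], against the positive second moment.
    This is the hypothesis of [exists_vertex]. *)
Lemma design_has_pos (R : realType) (n : nat) (C : {fset 'rV[R]_n}) (d : 'rV[R]_n) :
  (0 < n)%N -> spherical_design 5 C -> antipodal C -> d != 0 ->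
  has (fun x => 0 < dot x d) C.
Proof.
move=> n_gt0 dC antiC d_neq0; apply: contraT => /hasPn nonpos.
have orth x : x \in C -> dot x d = 0.
  move=> x_C; apply/eqP; rewrite eq_le !leNgt nonpos //=.
  by have := nonpos _ (antipodal_opp _ _ _ _ antiC x_C); rewrite dotNl oppr_gt0.
have := design_moment2 _ _ _ d n_gt0 dC.
rewrite big_seq big1 => [/esym/eqP|x x_C]; last by rewrite orth ?expr0n.
by rewrite gt_eqF // mulr_gt0 ?(design_card_gt0 _ _ _ n_gt0) // divr_gt0 ?dot_gt0 ?ltr0n.
Qed.

Lemma sup_dot_ge (R : realType) (n : nat) (C : {fset 'rV[R]_n}) (y : 'rV[R]_n) :
  (0 < n)%N -> spherical_design 5 C -> antipodal C -> sphere y ->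
  Num.sqrt (3 / (n%:R + 2)) <= sup [set dot x y | x in [set` C]]%classic.
Proof.
move=> n_gt0 dC antiC yS; set E := [set _ | _ in _]%classic; set s := sup E.
have C_gt0 := design_card_gt0 _ _ _ n_gt0 dC.
have n_pos : 0 < n%:R :> R by rewrite ltr0n.
have ub_s x : x \in C -> dot x y <= s.
  (* [sup] dominates the set only once an upper bound is known; on the sphere, 1 is one. *)
  move=> x_C; apply: ub_le_sup; last by exists x.
  by exists 1 => _ [z z_C <-]; apply: dot_sphere_le1 => //; exact: dC.1.
have sqr_s x : x \in C -> dot x y ^+ 2 <= s ^+ 2.
  (* The bounds at [x] and [- x] together say that the absolute value of [dot x y] is at most
     [s]. *)
  move=> x_C; have := ub_s x x_C; have := ub_s _ (antipodal_opp _ _ _ _ antiC x_C).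
  rewrite dotNl; nra.
have s_ge0 : 0 <= s.
  have [x x_C] : exists x, x \in C.
    by apply/fset0Pn; rewrite -cardfs_gt0 -(ltr0n R).
  have := ub_s x x_C; have := ub_s _ (antipodal_opp _ _ _ _ antiC x_C).
  rewrite dotNl; lra.
have : \sum_(x <- C) dot x y ^+ 4 <= \sum_(x <- C) s ^+ 2 * dot x y ^+ 2.
  rewrite big_seq [leRHS]big_seq; apply: ler_sum => x x_C.
  by rewrite -[4%N]/(2 + 2)%N exprD ler_wpM2r ?sqr_ge0 ?sqr_s.
rewrite -mulr_sumr design_moment2 // design_moment4 // (yS : dot y y = 1).
rewrite [leRHS]mulrCA ler_pM2l // => le_s.
rewrite -[s]ger0_norm // -sqrtr_sqr ler_wsqrtr //.
rewrite -(ler_pM2r (x := n%:R^-1)) ?invr_gt0 //.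
by move: le_s; rewrite expr1n !mulr1 !mul1r invfM [n%:R^-1 * _]mulrC mulrA.
Qed.

(** * The upper bound at a vertex *)

(* Cauchy-Schwarz between [g] and the centred indicator [h - M / N], where
   [N = size s]. *)
Lemma indicator_variance (R : realType) (T : eqType) (s : seq T) (g h : T -> R)
    (d K M : R) :
  0 < K -> 0 < M ->
  \sum_(x <- s) g x = 0 -> \sum_(x <- s) g x ^+ 2 = (size s)%:R * K ->
  \sum_(x <- s) h x = M -> (forall x, h x ^+ 2 = h x) -> (forall x, g x * h x = d * h x) ->
  M * d ^+ 2 <= K * ((size s)%:R - M).
Proof.
move=> K_gt0 M_gt0 g0 g2 hM hh gh; set N : R := (size s)%:R in g2 *.
have N_gt0 : 0 < N.
  rewrite ltr0n lt0n size_eq0; apply: contraTneq M_gt0 => s0.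
  by rewrite -hM s0 big_nil ltxx.
(* Up to a common factor [N], the weights [d * M] and [K] are the inner product of [g] with
   [N * h - M] and the squared norm of [g], as in the usual proof of Cauchy-Schwarz. *)
have : 0 <= \sum_(x <- s) (d * M * g x - K * (N * h x - M)) ^+ 2.
  by apply: sumr_ge0 => x _; rewrite sqr_ge0.
under eq_bigr => x _.
  rewrite (_ : _ ^+ 2 = (d * M) ^+ 2 * g x ^+ 2 + 2 * d * M * K * M * g x +
    (- 2 * d * M * K * N * d + K ^+ 2 * N ^+ 2 - 2 * K ^+ 2 * N * M) * h x +
    K ^+ 2 * M ^+ 2); last first.
    transitivity ((d * M) ^+ 2 * g x ^+ 2 + 2 * d * M * K * M * g x
      - 2 * d * M * K * N * (g x * h x) + K ^+ 2 * N ^+ 2 * h x ^+ 2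
      - 2 * K ^+ 2 * N * M * h x + K ^+ 2 * M ^+ 2); first by ring.
    by rewrite gh hh; ring.
  over.
rewrite !big_split /= -!mulr_sumr g0 g2 hM big_const_seq count_predT iter_addr_0.
rewrite -mulr_natr -/N.
rewrite (_ : _ + _ = (N * K * M) * (K * (N - M) - M * d ^+ 2)); last by ring.
by rewrite pmulr_rge0 ?subr_ge0 // !mulr_gt0.
Qed.

Lemma vertex_sqr_norm_le (R : realType) (n : nat) (C : {fset 'rV[R]_n}) (z : 'rV[R]_n) :
  (2 <= n)%N -> spherical_design 5 C -> antipodal C ->
  z != 0 -> (n <= count (fun x => dot x z == 1%R) C)%N ->
  (dot z z)^-1 <= 1 / n%:R + 1 / n%:R *
    Num.sqrt ((n%:R - 1) * (#|` C|%:R - 2 * n%:R) / (n%:R * (n%:R + 2))).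
Proof.
move=> n_ge2 dC antiC z_neq0 tight; have n_gt0 : (0 < n)%N := ltnW n_ge2.
have n_pos : 0 < n%:R :> R by rewrite ltr0n.
have n_gt1 : 0 < n%:R - 1 :> R by rewrite subr_gt0 ltr1n.
have n2_pos : 0 < n%:R + 2 :> R by rewrite addr_gt0.
set r := dot z z; have r_gt0 : 0 < r := dot_gt0 _ _ _ z_neq0.
set N : R := #|` C|%:R; set m := count _ _ in tight.
(* For [y] along [z], the square of [dot x y] is [dot x z ^+ 2 / r]. Its mean over [C] is [1 / n],
   and [d] is its excess over the mean where [dot x z] is 1 or -1. *)
set d := r^-1 - n%:R^-1.
(* The variance of that square on [C]: [3 / (n * (n + 2)) - 1 / n ^+ 2]. *)
pose K : R := 2 * (n%:R - 1) / (n%:R ^+ 2 * (n%:R + 2)).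
pose g (x : 'rV[R]_n) := dot x z ^+ 2 / r - n%:R^-1.
pose h (x : 'rV[R]_n) : R := (dot x z == 1)%:R + (dot x z == -1)%:R.
have sum_tight : \sum_(x <- C) (dot x z == 1)%:R = m%:R :> R.
  by rewrite -natr_sum /m -sum1_count [in RHS]big_mkcond; congr _%:R; apply: eq_bigr => x _; case: eqP.
have main : (2 * m%:R) * d ^+ 2 <= K * (N - 2 * m%:R).
  apply: (@indicator_variance R _ C g h).
  - by rewrite divr_gt0 // mulr_gt0 // exprn_gt0.
  - by rewrite mulr_gt0 // ltr0n (leq_trans n_gt0).
  - rewrite sumrB -mulr_suml design_moment2 // big_const_seq count_predT iter_addr_0.
    rewrite -/r -mulr_natr -/N; field.
    by rewrite !gt_eqF.
  - under eq_bigr => x _.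
      rewrite (_ : _ ^+ 2 = r^-1 ^+ 2 * dot x z ^+ 4 +
        (- 2 * r^-1 * n%:R^-1) * dot x z ^+ 2 + n%:R^-1 ^+ 2); last by rewrite /g; ring.
      over.
    rewrite !big_split /= -!mulr_sumr design_moment2 // design_moment4 //.
    rewrite big_const_seq count_predT iter_addr_0 -/r -mulr_natr -/N /K; field.
    by rewrite !gt_eqF.
  (* By antipodality the value -1 is taken as often as the value 1. *)
  - rewrite big_split /= sum_tight -(antipodal_sum _ _ _ _ antiC).
    under eq_bigr do rewrite dotNl eqr_oppLR opprK.
    by rewrite sum_tight; ring.
  - move=> x; rewrite /h; case: eqP => [->|_]; last by case: eqP; rewrite ?add0r ?expr1n ?expr0n.
    by rewrite -subr_eq0 opprK gt_eqF ?addr_gt0 // addr0 expr1n.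
  - move=> x; rewrite /g /h /d.
    case: eqP => [->|_]; first by rewrite expr1n mul1r.
    by case: eqP => [->|_]; rewrite ?addr0 ?mulr0 // sqrrN expr1n mul1r.
have m_ge : n%:R <= m%:R :> R by rewrite ler_nat.
rewrite !div1r.
suff d_le : n%:R * d <= Num.sqrt ((n%:R - 1) * (N - 2 * n%:R) / (n%:R * (n%:R + 2))).
  rewrite -lerBlDl -/d -(ler_pM2l n_pos) mulrA divff ?gt_eqF // mul1r //.
apply: (le_trans (ler_norm _)); rewrite -sqrtr_sqr ler_wsqrtr //.
have K_gt0 : 0 < K by rewrite divr_gt0 // mulr_gt0 // exprn_gt0.
(* Replacing [m] by the smaller [n] decreases the left side of [main] and increases its right
   side. *)
have : 2 * n%:R * d ^+ 2 <= K * (N - 2 * n%:R).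
  have := sqr_ge0 d; nra.
(* The factor [n / 2] turns the left side into [(n * d) ^+ 2]. *)
rewrite -(ler_pM2l (x := n%:R / 2)) ?divr_gt0 // => le_d.
rewrite (_ : _ ^+ 2 = n%:R / 2 * (2 * n%:R * d ^+ 2)); last by field.
apply: le_trans le_d _; rewrite le_eqVlt; apply/orP; left; apply/eqP.
by rewrite /K; field; rewrite !gt_eqF.
Qed.

Theorem theorem5p7 (R : realType) (n : nat) (C : {fset 'rV[R]_n})
    (n_ge2 : (2 <= n)%N)
    (C_design : spherical_design 5 C)
    (C_antipodal : antipodal C) :
  Num.sqrt (3 / (n%:R + 2)) <= rho C /\
  rho C <=
    Num.sqrt (1 / n%:R +
      1 / n%:R *
      Num.sqrt ((n%:R - 1) * (#|` C|%:R - 2 * n%:R) / (n%:R * (n%:R + 2)))).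
Proof.
have n_gt0 : (0 < n)%N := ltnW n_ge2.
have [x0 x0_C] : exists x, x \in C.
  by apply/fset0Pn; rewrite -cardfs_gt0 -(ltr0n R) (design_card_gt0 _ _ _ n_gt0).
split.
  apply: lb_le_inf; first by eexists; exists x0 => //; exact: C_design.1.
  by move=> _ [y yS <-]; apply: sup_dot_ge.
have [z feas tight] := exists_vertex _ _ C
  (fun d => design_has_pos _ _ _ d n_gt0 C_design C_antipodal).
have z_neq0 : z != 0.
  (* At the origin no constraint is tight. *)
  apply: contraTneq tight => ->; rewrite -ltnNge (leq_trans _ n_gt0) // ltnS leqn0.
  by under eq_count do rewrite dot0r eq_sym oner_eq0; rewrite count_pred0.
have r_gt0 := dot_gt0 _ _ _ z_neq0; set r := dot z z in r_gt0.
have vS : sphere ((Num.sqrt r)^-1 *: z).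
  rewrite /sphere /= dotZl dotZr mulrA -invfM -expr2 sqr_sqrtr ?ltW // mulVf //.
  by rewrite gt_eqF.
(* Feasibility of [z] bounds every [dot x y] by [1 / sqrt r] for the unit vector [y] along [z]. *)
apply: (@le_trans _ _ (Num.sqrt r)^-1); last first.
  rewrite -sqrtrV ?(ltW r_gt0) //. apply: ler_wsqrtr; exact: vertex_sqr_norm_le.
apply: (le_trans (ge_inf _ (ex_intro2 _ _ _ vS erefl))).
  (* [inf] lies below its elements only if the set is bounded below; the lower bound already proved
     serves here. *)
  by exists (Num.sqrt (3 / (n%:R + 2))) => _ [y yS <-]; apply: sup_dot_ge.
apply: ge_sup; first by eexists; exists x0.
by move=> _ [x x_C <-]; rewrite dotZr ler_piMr ?invr_ge0 ?sqrtr_ge0 ?feas.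
Qed.
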